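(* Let $C,A_1,\dots,A_M$ be real symmetric $N\times N$ matrices and $b\in\mathbb{R}^M$ with $\operatorname{Tr}(A_i^TA_j)=0$ for $i\ne j$, $\operatorname{Tr}(A_i^TC)=0$, $\|C\|_F=\|A_i\|_F=1$. Fix $c\in\mathbb{R}$ and let $S_c=\{X\succeq0:\operatorname{Tr}(A_i^TX)=b_i\ \forall i,\ \operatorname{Tr}(C^TX)=c\}$; assume $S_c$ contains a positive definite matrix and let $X_t$ be the (unique) maximizer of $\log\det X$ over $S_c$. Let $X_L\in S_c$, $X_L\succ0$, be $\epsilon_C$-optimal in the sense that $$\epsilon_C\ \ge\ (N-1)\big(\log\det X_t-\log\det X_L\big)\ \ge 0 .$$ Let $U_t,U_L$ be the Cholesky factors of $X_t,X_L$ ($X_t=U_t^TU_t$, $X_L=U_L^TU_L$). Let $K=DD_N$ and $\Phi'=\frac{2}{N+1}$, or $K=SDD_N$ and $\Phi'=1$, and let $0<\Phi<\Phi'$. Define $Q=U_t^{-T}CU_t^{-1}$, $\hat Y=I-\sqrt{\Phi}\,Q/\|Q\|_F$ and $\hat X=U_t^T\hat YU_t$. If $$\epsilon_C\le \epsilon_c^*=-\log\left(1-\left(\frac{\sqrt{\Phi'}-\sqrt{\Phi}}{\sqrt N+\sqrt{\Phi'}}\right)^3\right),$$ then the optimal value of the decrease step taken from $X_L$, $$\min_{X,Y}\operatorname{Tr}(C^TX)\ \text{s.t.}\ \operatorname{Tr}(A_i^TX)=b_i\ (i=1,\dots,M),\ X=U_L^TYU_L,\ Y\in K,$$ is at most $\operatorname{Tr}(C^T\hat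 X)$.
   Context: $X\in DD_N$ (diagonally dominant) means $X$ symmetric with $X(i,i)\ge\sum_{j\ne i}|X(i,j)|$ for all $i$; $X\in SDD_N$ (scaled diagonally dominant) means $X=DYD$ with $D$ positive diagonal and $Y\in DD_N$. Cholesky factor of $X\succ0$: upper-triangular $U$ with $X=U^TU$. *)

(* Defs.v *)
From mathcomp Require Import all_boot all_order all_algebra.
From mathcomp Require Import reals exp.
Set Implicit Arguments. Unset Strict Implicit. Unset Printing Implicit Defensive.
Import Order.TTheory GRing.Theory Num.Theory.
Local Open Scope ring_scope.

Section Defs.
Variable R : realType.
Variable N : nat.

Definition symmx (X : 'M[R]_N) : Prop := X^T = X.

Definition psdmx (X : 'M[R]_N) : Prop :=
  symmx X /\ forall x : 'cV[R]_N, 0 <= (x^T *m X *m x) 0 0.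

Definition pdmx (X : 'M[R]_N) : Prop :=
  symmx X /\ forall x : 'cV[R]_N, x != 0 -> 0 < (x^T *m X *m x) 0 0.

Definition frob (X : 'M[R]_N) : R := Num.sqrt (\tr (X^T *m X)).

Definition logdet (X : 'M[R]_N) : R := ln (\det X).

Definition isDD (X : 'M[R]_N) : Prop :=
  symmx X /\ forall i : 'I_N, \sum_(j | j != i) `|X i j| <= X i i.

Definition isSDD (X : 'M[R]_N) : Prop :=
  exists (d : 'rV[R]_N) (Y : 'M[R]_N),
    (forall i, 0 < d 0 i) /\ isDD Y /\ X = diag_mx d *m Y *m diag_mx d.

Definition upper_trig (U : 'M[R]_N) : Prop :=
  forall i j : 'I_N, (j < i)%N -> U i j = 0.

Definition cholesky_factor (X U : 'M[R]_N) : Prop :=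
  upper_trig U /\ X = U^T *m U.

End Defs.

(* Main.v *)
(** Write T = U_L U_t^-1 and W = T^-1.  The witness is X = X_L - l C with
    l = sqrt Phi / |Q|_F: it meets the constraints because C is orthogonal to
    every A_i, it has the same objective value as Xhat = X_t - l C, and
    Y = I - l W^T Q W.  Both cones contain the ball of radius sqrt Phi' around
    I, so it suffices that |W^T v|^2 <= (sqrt Phi' / sqrt Phi) |v|^2.

    Maximality of det at X_t along the segment to X_L gives tr (T^T T) <= N.
    Applying det M <= exp (tr M - N) to M = T^T T + k v v^T with
    k = (1 - x) / |v|^2 and x = |v|^2 / |W^T v|^2 then yields, if x < 1,
    det (T^T T) <= x exp (1 - x) <= 1 - (1 - x)^2 / 4, which contradicts the
    bound on epsC as soon as x < sqrt Phi / sqrt Phi'. *)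

Require Import Defs.
From mathcomp Require Import all_boot all_order all_algebra.
From mathcomp Require Import ring lra.
From mathcomp Require Import reals sequences exp.
Import Order.TTheory GRing.Theory Num.Theory.
Local Open Scope ring_scope.

(** * Determinants of low-rank updates of the identity *)

Lemma det_1DmulmxC (R : comNzRingType) (m n : nat)
    (A : 'M[R]_(m, n)) (B : 'M[R]_(n, m)) :
  \det (1%:M + A *m B) = \det (1%:M + B *m A).
Proof.
(* One block matrix is factored both as lower times upper and as upper times lower triangular; the
   two diagonals carry the two determinants. *)
have lhs : block_mx 1%:M (- A) B 1%:M =
    block_mx 1%:M 0 B 1%:M *m block_mx 1%:M (- A) 0 (1%:M + B *m A).
  rewrite mulmx_block !(mul1mx, mulmx1, mul0mx, mulmx0, addr0).
  by rewrite mulmxN addrC addrK.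
have rhs : block_mx 1%:M (- A) B 1%:M =
    block_mx (1%:M + A *m B) (- A) 0 1%:M *m block_mx 1%:M 0 B 1%:M.
  rewrite mulmx_block !(mul1mx, mulmx1, mul0mx, mulmx0, add0r).
  by rewrite mulNmx addrK.
have := congr1 determinant lhs; rewrite rhs !det_mulmx.
by rewrite !det_ublock !det_lblock !det1 !mul1r !mulr1.
Qed.

Lemma det_1Drank1 (R : comNzRingType) (n : nat) (k : R) (w : 'cV[R]_n) :
  \det (1%:M + k *: (w *m w^T)) = 1 + k * \tr (w^T *m w).
Proof.
rewrite scalemxAl det_1DmulmxC -scalemxAr det_mx11 /mxtrace big_ord1.
by rewrite !mxE.
Qed.

(** * Gram traces and the Frobenius norm *)

Section Frobenius.
Variable R : realType.

Lemma trace_gramE (m n : nat) (X : 'M[R]_(m, n)) :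
  \tr (X^T *m X) = \sum_j \sum_i X i j ^+ 2.
Proof.
rewrite /mxtrace; apply: eq_bigr => j _; rewrite mxE.
by apply: eq_bigr => i _; rewrite mxE expr2.
Qed.

Lemma trace_gram_ge0 (m n : nat) (X : 'M[R]_(m, n)) : 0 <= \tr (X^T *m X).
Proof.
by rewrite trace_gramE; do 2!apply: sumr_ge0 => ? _; apply: sqr_ge0.
Qed.

Lemma trace_gram_gt0 (m n : nat) (X : 'M[R]_(m, n)) :
  X != 0 -> 0 < \tr (X^T *m X).
Proof.
move=> X0; rewrite lt_def trace_gram_ge0 andbT; apply: contraNneq X0.
rewrite trace_gramE => /psumr_eq0P s0.
apply/eqP/matrixP => i j; rewrite mxE.
have /psumr_eq0P z0 : \sum_i X i j ^+ 2 = 0.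
  by apply: s0 => // k _; apply: sumr_ge0 => ? _; apply: sqr_ge0.
by apply/eqP; rewrite -sqrf_eq0; apply/eqP/z0 => // k _; apply: sqr_ge0.
Qed.

Lemma quad_trace (n : nat) (M : 'M[R]_n) (x : 'cV[R]_n) :
  (x^T *m M *m x) 0 0 = \tr (x^T *m M *m x).
Proof. by rewrite /mxtrace big_ord1. Qed.

(** A Gram trace is the sum of the squared column norms, so a bound on vectors is applied to each
    column of [Z]. *)
Lemma trace_gram_mul_le (m n p : nat) (W : 'M[R]_(m, n)) (k : R) :
  (forall v : 'cV[R]_n, \tr ((W *m v)^T *m (W *m v)) <= k * \tr (v^T *m v)) ->
  forall Z : 'M[R]_(n, p),
    \tr ((W *m Z)^T *m (W *m Z)) <= k * \tr (Z^T *m Z).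
Proof.
move=> Wk Z; rewrite !trace_gramE mulr_sumr; apply: ler_sum => j _.
have WZ : W *m col j Z = col j (W *m Z) by rewrite !colE mulmxA.
have := Wk (col j Z); rewrite WZ !trace_gramE !big_ord1.
under eq_bigr do rewrite mxE.
by under [X in _ <= k * X]eq_bigr do rewrite mxE.
Qed.

Lemma trace_gramT (m n : nat) (X : 'M[R]_(m, n)) :
  \tr ((X^T)^T *m X^T) = \tr (X^T *m X).
Proof. by rewrite trmxK mxtrace_mulC. Qed.

(** Here [k] bounds the squared operator norm of [W^T]. It is used once for the left factor and,
    after transposing, once for the right one; each use costs [sqrt k] in Frobenius norm. *)
Lemma frob_conj_le (n : nat) (W Q : 'M[R]_n) (k : R) : 0 <= k ->
  (forall v : 'cV[R]_n,
    \tr ((W^T *m v)^T *m (W^T *m v)) <= k * \tr (v^T *m v)) ->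
  frob (W^T *m Q *m W) <= k * frob Q.
Proof.
move=> k0 Wk; rewrite /frob -[k in leRHS]ger0_norm // -sqrtr_sqr -sqrtrM ?sqr_ge0//.
rewrite ler_sqrt; last by rewrite mulr_ge0 ?sqr_ge0 ?trace_gram_ge0.
rewrite -mulmxA; apply: (le_trans (trace_gram_mul_le _ _ _ _ _ Wk _)).
rewrite expr2 -mulrA ler_wpM2l // -trace_gramT trmx_mul.
by apply: (le_trans (trace_gram_mul_le _ _ _ _ _ Wk _)); rewrite trace_gramT.
Qed.

End Frobenius.

(** * Positive definite matrices: determinant against trace *)

Section PositiveDefinite.
Variable R : realType.

Lemma pdmx_congr (n : nat) (M L : 'M[R]_n) :
  L \in unitmx -> pdmx M -> pdmx (L^T *m M *m L).
Proof.
move=> uL [sM pM]; split=> [|x x0]; first by rewrite /symmx !trmx_mul trmxK sM mulmxA.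
have := pM (L *m x); rewrite trmx_mul !mulmxA; apply.
by apply: contraNneq x0 => Lx0; rewrite -(mulKmx uL x) Lx0 mulmx0.
Qed.

Lemma pdmx_drsub (m n : nat) (M : 'M[R]_(m + n)) : pdmx M -> pdmx (drsubmx M).
Proof.
move=> [sM pM]; split=> [|x x0]; first by rewrite /symmx trmx_drsub sM.
have := pM (col_mx 0 x); rewrite -{1}[M]submxK tr_col_mx mul_row_block mul_row_col.
rewrite trmx0 !mul0mx !mulmx0 !add0r; apply.
by apply: contraNneq x0; rewrite -(col_mx0 R m n 1) => /eq_col_mx[_ ->].
Qed.

Lemma pdmx_diag_gt0 (n : nat) (M : 'M[R]_n) i : pdmx M -> 0 < M i i.
Proof.
move=> [_ pM]; have := pM (delta_mx i 0).
rewrite trmx_delta -rowE -colE !mxE; apply.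
by apply/eqP => /matrixP /(_ i 0); rewrite !mxE !eqxx => /eqP; rewrite oner_eq0.
Qed.

(* The Schur complement has smaller trace, which reduces to [a <= expR (a - 1)]
   for the pivots. *)
Lemma pdmx_det_bounds (n : nat) (M : 'M[R]_n) :
  pdmx M -> 0 < \det M <= expR (\tr M - n%:R).
Proof.
elim: n M => [|n IHn] M pM.
  by rewrite det_mx00 /mxtrace big_ord0 subr0 expR0 ltr01 lexx.
rewrite -[n.+1]/(1 + n)%N in M pM *.
pose a := M 0 0; have a0 : 0 < a := pdmx_diag_gt0 _ _ 0 pM.
pose r : 'rV_n := ursubmx M.
have ME : M = block_mx a%:M r r^T (drsubmx M).
  rewrite -[LHS]submxK; congr block_mx; last by rewrite trmx_ursub pM.1.
  by apply/matrixP => i j; rewrite !ord1 !mxE eqxx mulr1n; congr (M _ _); apply: val_inj.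
pose L : 'M_(1 + n) := block_mx 1%:M (- a^-1 *: r) 0 1%:M.
have dL : \det L = 1 by rewrite det_ublock !det1 mulr1.
have uL : L \in unitmx by rewrite unitmxE dL unitr1.
pose S := drsubmx M - a^-1 *: (r^T *m r).
have LML : L^T *m M *m L = block_mx a%:M 0 0 S.
  rewrite ME tr_block_mx !trmx1 trmx0 !mulmx_block !(mulmx0, mul0mx, mul1mx, mulmx1, addr0).
  have z1 : a%:M *m (- a^-1 *: r) + r = 0.
    by rewrite mul_scalar_mx scalerA mulrN mulfV ?gt_eqF// scaleN1r addNr.
  have z2 : (- a^-1 *: r)^T *m a%:M + r^T = 0.
    by rewrite -[RHS]trmx0 -z1 linearD /= trmx_mul tr_scalar_mx.
  by rewrite z1 z2 mul0mx add0r linearZ /= -scalemxAl scaleNr addrC.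
have pS : pdmx S.
  by have := pdmx_drsub _ _ _ (pdmx_congr _ _ _ uL pM); rewrite LML block_mxKdr.
have dM : \det M = a * \det S.
  have := congr1 determinant LML; rewrite !det_mulmx det_tr dL mulr1 mul1r => ->.
  by rewrite det_ublock det_scalar1.
have /andP[S0 SN] := IHn _ pS.
rewrite dM mulr_gt0 //=.
have trM : \tr M = a + \tr S + a^-1 * \tr (r^T *m r).
  rewrite ME mxtrace_block {1}/mxtrace big_ord1 mxE eqxx mulr1n.
  by rewrite /S linearB linearZ /= -!addrA addNr addr0.
have le1 : a <= expR (a - 1) by have := expR_ge1Dx (a - 1); rewrite addrC subrK.
apply: (@le_trans _ _ (expR (a - 1) * expR (\tr S - n%:R))).
  by apply: ler_pM => //; exact: ltW.
rewrite -expRD ler_expR trM -natr1.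
have : 0 <= a^-1 * \tr (r^T *m r) by rewrite mulr_ge0 ?trace_gram_ge0 ?invr_ge0 ?ltW.
by move: (a^-1 * _) => t; lra.
Qed.

Lemma pdmx_gram_rank1 (n : nat) (T : 'M[R]_n) (k : R) (v : 'cV[R]_n) :
  T \in unitmx -> 0 <= k -> pdmx (T^T *m T + k *: (v *m v^T)).
Proof.
move=> uT k0; split=> [|x x0].
  by rewrite /symmx linearD linearZ /= !trmx_mul !trmxK.
rewrite quad_trace mulmxDr mulmxDl linearD /= -scalemxAr -scalemxAl linearZ /=.
have -> : x^T *m (T^T *m T) *m x = (T *m x)^T *m (T *m x).
  by rewrite trmx_mul !mulmxA.
have -> : x^T *m (v *m v^T) *m x = (v^T *m x)^T *m (v^T *m x).
  by rewrite trmx_mul trmxK !mulmxA.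
rewrite ltr_wpDr ?mulr_ge0 ?trace_gram_ge0 // trace_gram_gt0 //.
by apply: contraNneq x0 => Tx0; rewrite -(mulKmx uT x) Tx0 mulmx0.
Qed.

(** The left side is the determinant of [T^T *m T + k *: (v *m v^T)], since [T] factors out and
    leaves a rank-one update of the identity by [w]. The right side bounds the exponential of its
    trace minus [n]. *)
Lemma det_gram_rank1_le (n : nat) (T : 'M[R]_n) (k : R) (v w : 'cV[R]_n) :
  T \in unitmx -> 0 <= k -> \tr (T^T *m T) <= n%:R ->
  w = (invmx T)^T *m v ->
  \det T ^+ 2 * (1 + k * \tr (w^T *m w)) <= expR (k * \tr (v^T *m v)).
Proof.
move=> uT k0 trT wE.
have fac : T^T *m T + k *: (v *m v^T) = T^T *m (1%:M + k *: (w *m w^T)) *m T.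
  rewrite mulmxDr mulmxDl mulmx1 -scalemxAr -scalemxAl; congr (_ + _ *: _).
  rewrite wE trmx_mul trmxK !mulmxA -trmx_mul mulVmx // trmx1 mul1mx.
  by rewrite mulmxKV.
have /andP[_] := pdmx_det_bounds _ _ (pdmx_gram_rank1 _ _ _ v uT k0).
rewrite {1}fac !det_mulmx det_tr det_1Drank1 mulrAC -expr2.
move=> /le_trans; apply; rewrite ler_expR linearD linearZ /= [\tr (v *m _)]mxtrace_mulC.
by lra.
Qed.

End PositiveDefinite.

(** * From a determinant bound to a trace bound, and contraction of the inverse *)

Lemma horner_char_poly (R : comNzRingType) (n : nat) (E : 'M[R]_n) (z : R) :
  (char_poly (- E)).[z] = \det (z%:M + E).
Proof.
rewrite /char_poly -horner_evalE -det_map_mx; congr (\det _).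
apply/matrixP => i j; rewrite !mxE /= horner_evalE hornerD hornerN hornerMn.
by rewrite hornerX hornerC opprK.
Qed.

Section Optimality.
Variable R : realType.

(* [\tr E] is the second coefficient of the monic polynomial [\det (z%:M + E)]
   in [z]. *)
Lemma trace_le0_of_det (n : nat) (E : 'M[R]_n) :
  (forall z, 1 <= z -> \det (z%:M + E) <= z ^+ n) -> \tr E <= 0.
Proof.
case: n E => [|n] E detE; first by rewrite /mxtrace big_ord0.
set p := char_poly (- E).
pose G := \sum_(i < n) `|p`_i|.
have G0 : 0 <= G by apply: sumr_ge0.
(* Once the monic top term cancels, [\tr E * z ^+ n] is at most a sum of terms of degree below [n];
   multiplied by [z], that sum is at most [G * z ^+ n] because [1 <= z]. *)
have bound z : 1 <= z -> \tr E * z <= G.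
  move=> z1; have z0 : 0 < z := lt_le_trans ltr01 z1.
  have zn0 : 0 < z ^+ n by rewrite exprn_gt0.
  have := detE z z1; rewrite -horner_char_poly horner_coef size_char_poly.
  rewrite !big_ord_recr /=.
  have -> : (char_poly (- E))`_n.+1 = 1.
    by have /monicP := char_poly_monic (- E); rewrite lead_coefE size_char_poly.
  rewrite -[n in _`_n]/(n.+1.-1) char_poly_trace // linearN opprK mul1r -/p => le_z.
  have {le_z}le_z : \tr E * z ^+ n <= - \sum_(i < n) p`_i * z ^+ i.
    by move: le_z; set s := \sum_(_ < _) _; lra.
  rewrite -(ler_pM2r zn0) mulrAC.
  apply: (@le_trans _ _ ((\sum_(i < n) `|p`_i| * z ^+ i) * z)).
    rewrite ler_pM2r //; apply: (le_trans le_z).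
    rewrite -sumrN; apply: ler_sum => i _.
    by rewrite -mulNr ler_wpM2r ?exprn_ge0 ?(ltW z0)// -(normrN p`_i) ler_norm.
  rewrite /G !mulr_suml; apply: ler_sum => i _; rewrite -mulrA -exprSr.
  by rewrite ler_wpM2l // ler_weXn2l.
rewrite leNgt; apply/negP => t0.
(* At this point the left side equals [\tr E + G], which exceeds [G]. *)
have := bound (1 + G / \tr E); rewrite mulrDr mulr1 mulrCA mulfV ?gt_eqF// mulr1.
by rewrite lerDl divr_ge0 ?(ltW t0)// => /(_ isT); rewrite gerDr leNgt t0.
Qed.

(** Bounding [expR (- (u / 2))] below by its tangent [1 - u / 2] and squaring reduces the claim to a
    polynomial inequality whose gap is [u ^+ 3 / 4 * (1 - u / 4)]. *)
Lemma onem_expR_le (u : R) : 0 <= u <= 1 -> (1 - u) * expR u <= 1 - u ^+ 2 / 4.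
Proof.
move=> /andP[u0 u1]; pose h := expR (- (u / 2)).
have h0 : 0 < h := expR_gt0 _.
have hu : 1 - u / 2 <= h := expR_ge1Dx _.
have uh : expR u * h ^+ 2 = 1.
  by rewrite expr2 /h -!expRD (_ : u + _ = 0) ?expR0 //; field.
have h2 : (1 - u / 2) ^+ 2 <= h ^+ 2 by apply: lerXn2r => //; rewrite nnegrE; lra.
rewrite -(ler_pM2r (exprn_gt0 2 h0)) -mulrA uh mulr1.
apply: (@le_trans _ _ ((1 - u ^+ 2 / 4) * (1 - u / 2) ^+ 2)).
  rewrite -subr_ge0.
  have -> : (1 - u ^+ 2 / 4) * (1 - u / 2) ^+ 2 - (1 - u) = u ^+ 3 / 4 * (1 - u / 4).
    by field.
  by rewrite !mulr_ge0 ?exprn_ge0 //; lra.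
by rewrite ler_wpM2l //; nra.
Qed.

Lemma gram_inv_contract (n : nat) (T : 'M[R]_n) (q : R) :
  T \in unitmx -> \tr (T^T *m T) <= n%:R -> 0 < q <= 1 ->
  1 - (1 - q) ^+ 2 / 4 <= \det T ^+ 2 ->
  forall v : 'cV[R]_n,
    \tr (((invmx T)^T *m v)^T *m ((invmx T)^T *m v)) <= q^-1 * \tr (v^T *m v).
Proof.
move=> uT trT /andP[q0 q1] detT v.
have [->|v0] := eqVneq v 0; first by rewrite !mulmx0 linear0 mulr0.
have := trace_gram_gt0 _ _ _ _ v0; set V := \tr (v^T *m v) => V0.
set w := (invmx T)^T *m v; set Y := \tr (w^T *m w).
rewrite leNgt; apply/negP => VY.
have Y0 : 0 < Y by apply: lt_trans VY; rewrite mulr_gt0 ?invr_gt0.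
pose x := V / Y.
have x0 : 0 < x by rewrite divr_gt0.
have xq : x < q by rewrite /x ltr_pdivrMr // mulrC -ltr_pdivrMr // mulrC.
(* The weight [k = (1 - x) / V] minimises [expR (k * V) / (1 + k * Y)]: it gives [1 + k * Y = x^-1]
   and [k * V = 1 - x]. *)
have k0 : 0 <= (1 - x) / V by rewrite divr_ge0 ?(ltW V0) //; lra.
have := det_gram_rank1_le _ _ _ _ v w uT k0 trT erefl; rewrite -/V -/Y.
have -> : 1 + (1 - x) / V * Y = x^-1.
  by rewrite /x; field; rewrite !gt_eqF.
rewrite divfK ?gt_eqF// ler_pdivrMr // mulrC => detx.
have u01 : 0 <= 1 - x <= 1 by apply/andP; split; lra.
have := onem_expR_le _ u01; rewrite subKr => xe.
have := le_trans detT (le_trans detx xe).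
(* The chain forces [(1 - x) ^+ 2 <= (1 - q) ^+ 2], against [x < q <= 1]. *)
by nra.
Qed.

End Optimality.

(** * Frobenius balls around the identity inside the two cones *)

Section Balls.
Variable R : realType.

(** By symmetry the off-diagonal entries of row [i] recur in column [i], hence the factor 2. *)
Lemma symm_frob_row (n : nat) (Z : 'M[R]_n) (i : 'I_n) : symmx Z ->
  Z i i ^+ 2 + 2 * (\sum_(j | j != i) Z i j ^+ 2) <= \tr (Z^T *m Z).
Proof.
move=> sZ; rewrite trace_gramE [leRHS](bigD1 i) //= [X in _ <= X + _](bigD1 i) //=.
have sym j k : Z j k = Z k j by rewrite -{1}sZ mxE.
have <- : \sum_(j | j != i) Z j i ^+ 2 = \sum_(j | j != i) Z i j ^+ 2.
  by apply: eq_bigr => j _; rewrite sym.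
rewrite [2 * _](_ : _ = \sum_(j | j != i) Z j i ^+ 2 + \sum_(j | j != i) Z j i ^+ 2); last by ring.
rewrite addrA lerD2l; apply: ler_sum => j ji.
by rewrite (bigD1 i) //= sym lerDl sumr_ge0 // => ? _; rewrite sqr_ge0.
Qed.

(* Tangent-line bounds at the extremal row, with entries [2 / (n + 1)] on the
   diagonal and [1 / (n + 1)] off it. *)
Lemma isDD_ball (n : nat) (Z : 'M[R]_n) : symmx Z ->
  \tr (Z^T *m Z) <= 2 / (n%:R + 1) -> isDD (1%:M - Z).
Proof.
move=> sZ Zn; split=> [|i]; first by rewrite /symmx linearB /= trmx1 sZ.
rewrite !mxE eqxx mulr1n.
under eq_bigr => j ji do rewrite !mxE eq_sym (negPf ji) sub0r normrN.
pose m : R := n%:R + 1; have m0 : 0 < m by rewrite ltr_wpDl.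
have off : \sum_(j | j != i) `|Z i j| <=
    \sum_(j | j != i) (m / 2 * Z i j ^+ 2 + (2 * m)^-1).
  apply: ler_sum => j _; rewrite -subr_ge0 -real_normK ?num_real//.
  set t := `|_|.
  have -> : m / 2 * t ^+ 2 + (2 * m)^-1 - t = (m * t - 1) ^+ 2 / (2 * m).
    by field; rewrite gt_eqF.
  by rewrite divr_ge0 ?sqr_ge0 ?mulr_ge0 ?(ltW m0).
rewrite big_split /= -mulr_sumr sumr_const cardC1 card_ord -[_ *+ n.-1]mulr_natr in off.
have n1 : n.-1%:R = m - 2.
  by rewrite /m -subn1 natrB ?(leq_ltn_trans _ (ltn_ord i))//; lra.
rewrite n1 (_ : (2 * m)^-1 * (m - 2) = 2^-1 - m^-1) in off; last first.
  by field; rewrite gt_eqF.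
have dg : Z i i <= m / 4 * Z i i ^+ 2 + m^-1.
  rewrite -subr_ge0.
  have -> : m / 4 * Z i i ^+ 2 + m^-1 - Z i i = (m * Z i i - 2) ^+ 2 / (4 * m).
    by field; rewrite gt_eqF.
  by rewrite divr_ge0 ?sqr_ge0 ?mulr_ge0 ?(ltW m0).
have := le_trans (symm_frob_row _ _ i sZ) Zn; rewrite -/m ler_pdivlMr // => row.
(* In the sum of [off] and [dg] the terms [m^-1] cancel, leaving [1 / 2] plus [m / 4] times the row
   sum, which [row] bounds by another [1 / 2]. *)
by move: off dg row; set S := \sum_(_ | _) _ ^+ 2; set S' := \sum_(_ | _) `|_|; set mi := m^-1; nra.
Qed.

(* Rows of [Z] scaled by their Euclidean norms; by symmetry a zero row is also a
   zero column, so its weight is irrelevant. *)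
Lemma isSDD_ball (n : nat) (Z : 'M[R]_n) : symmx Z ->
  \tr (Z^T *m Z) <= 1 -> isSDD (1%:M - Z).
Proof.
move=> sZ Z1.
have sym j k : Z j k = Z k j by rewrite -{1}sZ mxE.
pose sg i := \sum_j Z i j ^+ 2.
have sg0 i : 0 <= sg i by apply: sumr_ge0 => ? _; apply: sqr_ge0.
have sgz i : sg i = 0 -> forall j, Z i j = 0.
  move=> /psumr_eq0P z j; apply/eqP; rewrite -sqrf_eq0; apply/eqP/z => // k _.
  exact: sqr_ge0.
have sumsg : \sum_i sg i <= 1.
  by move: Z1; rewrite trace_gramE exchange_big.
pose e i := if sg i == 0 then 1 else Num.sqrt (sg i).
have e0 i : 0 < e i.
  by rewrite /e; case: eqVneq => // s0; rewrite sqrtr_gt0 lt_def s0 sg0.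
have Ze i : \sum_j `|Z i j| * e j <= e i.
  have [s0|s0] := eqVneq (sg i) 0.
    by rewrite big1 ?(ltW (e0 i))// => j _; rewrite (sgz _ s0) normr0 mul0r.
  have ei : e i ^+ 2 = sg i by rewrite /e (negPf s0) sqr_sqrtr.
  (* AM-GM weighted so that, summed over [j], each half contributes at most [e i / 2]: the first
     because [sg i = e i ^+ 2], the second by [sumsg]. *)
  have le_j j : `|Z i j| * e j <= (Z i j ^+ 2 / e i + e i * sg j) / 2.
    have [sj0|sj0] := eqVneq (sg j) 0.
      by rewrite sym (sgz _ sj0) sj0 normr0 expr0n mulr0 !mul0r addr0 mul0r.
    rewrite -real_normK ?num_real// -subr_ge0.
    have <- : e j ^+ 2 = sg j by rewrite /e (negPf sj0) sqr_sqrtr.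
    set t := `|_|.
    have -> : (t ^+ 2 / e i + e i * e j ^+ 2) / 2 - t * e j =
        (t - e i * e j) ^+ 2 / (2 * e i) by field; rewrite gt_eqF.
    by rewrite divr_ge0 ?sqr_ge0 ?mulr_ge0 ?(ltW (e0 _)).
  apply: (le_trans (ler_sum _ (fun j _ => le_j j))).
  rewrite -mulr_suml big_split /= -mulr_suml -mulr_sumr -/(sg i) -ei expr2 mulfK ?gt_eqF//.
  by have := e0 i; nra.
exists (\row_i (e i)^-1), (\matrix_(i, j) (e i * (1%:M - Z) i j * e j)); split.
  by move=> i; rewrite mxE invr_gt0.
split; last first.
  rewrite mul_diag_mx mul_mx_diag; apply/matrixP => i j; rewrite !mxE.
  by field; rewrite !gt_eqF.
split=> [|i].
  apply/matrixP => i j; rewrite !mxE sym eq_sym; ring.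
rewrite !mxE eqxx mulr1n.
under eq_bigr => j ji.
  rewrite !mxE eq_sym (negPf ji) sub0r mulrN mulNr normrN !normrM.
  rewrite !(gtr0_norm (e0 _)) -mulrA; over.
rewrite -mulr_sumr -mulrA ler_pM2l //.
have := Ze i; rewrite (bigD1 i) //= mulrBl mul1r lerBrDl; apply: le_trans.
by rewrite lerD2r ler_wpM2r ?ler_norm ?(ltW (e0 i)).
Qed.

End Balls.

(** Links the cubic threshold on [epsC] (with [a = sqrt N]) to the determinant bound required by
    [gram_inv_contract]. The ratio is below 1, so its cube is at most its square, and [s' <= a]
    bounds its denominator below by [2 * s']. *)
Lemma cube_gap_le (R : realType) (s s' a : R) : 0 < s -> s < s' -> s' <= a ->
  0 < ((s' - s) / (a + s')) ^+ 3 < 1 /\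
  ((s' - s) / (a + s')) ^+ 3 <= (1 - s / s') ^+ 2 / 4.
Proof.
move=> s0 ss' s'a; set r := _ / _.
have s'0 : 0 < s' := lt_trans s0 ss'.
have r0 : 0 < r by rewrite divr_gt0 //; lra.
have r1 : r < 1 by rewrite /r ltr_pdivrMr; lra.
have rg : r <= (1 - s / s') / 2.
  rewrite /r (_ : (1 - s / s') / 2 = (s' - s) / (2 * s')); last by field; rewrite gt_eqF.
  by rewrite ler_pM2l ?subr_gt0// lef_pV2 ?posrE; lra.
split; first by rewrite exprn_gt0 // exprn_ilt1 ?ltW.
apply: (@le_trans _ _ (r ^+ 2)).
  by rewrite [r ^+ 3]exprS ler_piMl ?sqr_ge0 ?ltW.
rewrite (_ : _ / 4 = ((1 - s / s') / 2) ^+ 2); last by field; rewrite gt_eqF.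
by rewrite lerXn2r ?nnegrE ?(ltW r0)// (le_trans (ltW r0)).
Qed.

(** * First-order optimality at a determinant maximizer *)

Section DetMaximizer.
Variable R : realType.

Lemma frobZ (n : nat) (k : R) (X : 'M[R]_n) :
  0 <= k -> frob (k *: X) = k * frob X.
Proof.
move=> k0; rewrite /frob [(k *: X)^T]linearZ /= -scalemxAl -scalemxAr scalerA linearZ /= -expr2.
by rewrite sqrtrM ?sqr_ge0// sqrtr_sqr ger0_norm.
Qed.

Lemma pdmx_psdmx (n : nat) (X : 'M[R]_n) : pdmx X -> psdmx X.
Proof.
move=> [sX pX]; split=> // x; have [->|x0] := eqVneq x 0; last exact/ltW/pX.
by rewrite mulmx0 mxE.
Qed.

Lemma pdmx_conv (n : nat) (X Y : 'M[R]_n) (t : R) : 0 <= t -> t <= 1 ->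
  pdmx X -> pdmx Y -> pdmx ((1 - t) *: X + t *: Y).
Proof.
move=> t0 t1 [sX pX] [sY pY]; split=> [|x x0].
  by rewrite /symmx linearD !linearZ /= sX sY.
rewrite mulmxDr mulmxDl -!scalemxAr -!scalemxAl !mxE.
have := pX x x0; have := pY x x0; rewrite !mxE.
set p := \sum_(_ | _) _; set q := \sum_(_ | _) _ => p0 q0.
by nra.
Qed.

Lemma gram_pdmx_unit (n : nat) (X U : 'M[R]_n) :
  pdmx X -> X = U^T *m U -> U \in unitmx.
Proof.
move=> pX XE; have /andP[] := pdmx_det_bounds _ _ _ pX.
rewrite XE det_mulmx det_tr -expr2 => d0 _.
by rewrite unitmxE unitfE; move: d0; apply: contraTneq => ->; rewrite expr0n ltxx.
Qed.

(** No derivative is taken: factoring out [U] turns the segment into the one from the identity to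
    [T^T *m T], and scaling by [z = t^-1] gives the hypothesis of [trace_le0_of_det] for
    [E = T^T *m T - 1%:M]. *)
Lemma max_det_trace_le (n : nat) (X Y U T : 'M[R]_n) :
  pdmx X -> X = U^T *m U -> Y = (T *m U)^T *m (T *m U) ->
  (forall t, 0 <= t -> t <= 1 -> \det ((1 - t) *: X + t *: Y) <= \det X) ->
  \tr (T^T *m T) <= n%:R.
Proof.
move=> pX XE YE max.
rewrite -subr_le0 -mxtrace1 -linearB /=; apply: trace_le0_of_det => z z1.
have z0 : 0 < z := lt_le_trans ltr01 z1.
pose t := z^-1; pose G := (1 - t) *: 1%:M + t *: (T^T *m T).
have -> : z%:M + (T^T *m T - 1%:M) = z *: G.
  rewrite scalerDr !scalerA mulfV ?gt_eqF// mulrBr mulr1 mulfV ?gt_eqF// scale1r.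
  by rewrite scalerBl scale1r scalemx1 addrA addrAC.
have GE : (1 - t) *: X + t *: Y = U^T *m G *m U.
  rewrite XE YE trmx_mul mulmxDr mulmxDl -!scalemxAr -!scalemxAl mulmx1.
  by rewrite !mulmxA.
have t1 : t <= 1 by rewrite invf_le1.
have := max t; rewrite invr_ge0 (ltW z0) => /(_ isT t1).
have /andP[dX _] := pdmx_det_bounds _ _ _ pX; move: dX.
rewrite GE XE !det_mulmx det_tr mulrAC -expr2 => dU.
rewrite ger_pMr // => G1.
by rewrite detZ ger_pMr ?exprn_gt0.
Qed.

End DetMaximizer.

(** * Feasibility and value of the decrease step from [XL] *)

Theorem theorem4p14 (R : realType) (N M : nat)
    (C : 'M[R]_N) (A : 'I_M -> 'M[R]_N) (b : 'I_M -> R) (c : R)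
    (hCsym : symmx C) (hAsym : forall i, symmx (A i))
    (hAorth : forall i j, i != j -> \tr ((A i)^T *m A j) = 0)
    (hAC : forall i, \tr ((A i)^T *m C) = 0)
    (hCnorm : frob C = 1) (hAnorm : forall i, frob (A i) = 1)
    (Sc : 'M[R]_N -> Prop)
    (hSc : forall X, Sc X <->
       [/\ psdmx X, (forall i, \tr ((A i)^T *m X) = b i) & \tr (C^T *m X) = c])
    (hSc_pd : exists X, Sc X /\ pdmx X)
    (Xt : 'M[R]_N) (hXtS : Sc Xt) (hXtpd : pdmx Xt)
    (hXtmax : forall X, Sc X -> pdmx X -> logdet X <= logdet Xt)
    (XL : 'M[R]_N) (hXLS : Sc XL) (hXLpd : pdmx XL)
    (epsC : R)
    (hepsC : (N%:R - 1) * (logdet Xt - logdet XL) <= epsC)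
    (hepsC0 : 0 <= (N%:R - 1) * (logdet Xt - logdet XL))
    (Ut UL : 'M[R]_N) (hUt : cholesky_factor Xt Ut) (hUL : cholesky_factor XL UL)
    (K : 'M[R]_N -> Prop) (Phi' : R)
    (hK : (K = @isDD R N /\ Phi' = 2 / (N%:R + 1)) \/ (K = @isSDD R N /\ Phi' = 1))
    (Phi : R) (hPhi0 : 0 < Phi) (hPhi1 : Phi < Phi')
    (Q Yhat Xhat : 'M[R]_N)
    (hQ : Q = (invmx Ut)^T *m C *m invmx Ut)
    (hYhat : Yhat = 1%:M - (Num.sqrt Phi / frob Q) *: Q)
    (hXhat : Xhat = Ut^T *m Yhat *m Ut)
    (hepsstar : epsC <= - ln (1 - ((Num.sqrt Phi' - Num.sqrt Phi)
                                  / (Num.sqrt N%:R + Num.sqrt Phi')) ^+ 3)) :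
  exists X Y : 'M[R]_N,
    [/\ (forall i, \tr ((A i)^T *m X) = b i), X = UL^T *m Y *m UL, K Y
      & \tr (C^T *m X) <= \tr (C^T *m Xhat)].
Proof.
have [/hSc[_ hAt hCt] /hSc[_ hAL hCL]] := (hXtS, hXLS).
have [[_ XtE] [_ XLE]] := (hUt, hUL).
have uUt := gram_pdmx_unit _ _ _ _ hXtpd XtE.
have uUL := gram_pdmx_unit _ _ _ _ hXLpd XLE.
have /andP[dXt0 _] := pdmx_det_bounds _ _ _ hXtpd.
have /andP[dXL0 _] := pdmx_det_bounds _ _ _ hXLpd.
have N0 : (0 < N)%N.
  rewrite lt0n; apply/eqP => N0; move: hCnorm; rewrite /frob trace_gramE big1 => [|i].
    by rewrite sqrtr0 => /eqP; rewrite eq_sym oner_eq0.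
  by have := ltn_ord i; rewrite {2}N0.
have [Phi'0 Phi'1] : 0 < Phi' /\ Phi' <= 1.
  have N1 : 1 <= N%:R :> R by rewrite ler1n.
  case: hK => -[_ ->] //; split; first by rewrite divr_gt0 //; lra.
  by rewrite ler_pdivrMr; lra.
set s := Num.sqrt Phi in hYhat hepsstar *.
set s' := Num.sqrt Phi' in hepsstar *.
have s0 : 0 < s by rewrite sqrtr_gt0.
have s'0 : 0 < s' by rewrite sqrtr_gt0.
have ss' : s < s' by rewrite ltr_sqrt.
pose T := UL *m invmx Ut; pose W := Ut *m invmx UL.
have WT : W *m T = 1%:M by rewrite /W /T mulmxA mulmxKV // mulmxV.
have [_ uT] := mulmx1_unit WT.
have invT : invmx T = W by rewrite -[LHS]mul1mx -WT mulmxK.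
have TU : T *m Ut = UL by rewrite /T mulmxKV.
have dT : \det T ^+ 2 = \det XL / \det Xt.
  have -> : \det Xt = \det Ut ^+ 2 by rewrite XtE det_mulmx det_tr.
  have -> : \det XL = \det UL ^+ 2 by rewrite XLE det_mulmx det_tr.
  have -> : \det UL = \det T * \det Ut by rewrite -det_mulmx TU.
  by field; rewrite -unitfE -unitmxE.
have trT : \tr (T^T *m T) <= N%:R.
  apply: (max_det_trace_le _ _ _ XL _ _ hXtpd XtE); first by rewrite TU.
  move=> t t0 t1; have pZ := pdmx_conv _ _ _ _ _ t0 t1 hXtpd hXLpd.
  have /andP[dZ0 _] := pdmx_det_bounds _ _ _ pZ.
  rewrite -ler_ln ?posrE//; apply: (hXtmax _ _ pZ); apply/hSc; split.
  - exact: pdmx_psdmx.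
  - by move=> i; rewrite mulmxDr -!scalemxAr linearD !linearZ /= hAt hAL; ring.
  - by rewrite mulmxDr -!scalemxAr linearD !linearZ /= hCt hCL; ring.
have q01 : 0 < s / s' <= 1 by rewrite divr_gt0 //= ler_pdivrMr // mul1r ltW.
have detT : 1 - (1 - s / s') ^+ 2 / 4 <= \det T ^+ 2.
  (* For [N = 1] the factor [N%:R - 1] vanishes and [epsC] says nothing about the log-det gap;
     instead the constraint on [C], whose only entry is nonzero, forces [XL = Xt]. *)
  have [N1|N1] := leqP N 1.
    have {}N1 : N = 1 by apply/eqP; rewrite eqn_leq N1.
    suff -> : \det T ^+ 2 = 1 by rewrite gerBl divr_ge0 ?sqr_ge0.
    rewrite dT; suff -> : XL = Xt by rewrite mulfV ?gt_eqF.
    have C0 : C != 0.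
      by apply: contra_eqN hCnorm => /eqP->; rewrite /frob mulmx0 linear0 sqrtr0 eq_sym oner_eq0.
    have ord1N (i j : 'I_N) : i = j.
      by apply: val_inj; case: i j => i + [j +] /=; rewrite N1 !ltnS !leqn0 => /eqP-> /eqP->.
    pose i0 := Ordinal N0.
    have trC (X : 'M[R]_N) : \tr (C^T *m X) = C i0 i0 * X i0 i0.
      by rewrite /mxtrace (big_pred1 i0) ?mxE ?(big_pred1 i0) ?mxE // => i; apply/esym/eqP/ord1N.
    have c0 : C i0 i0 != 0.
      apply: contraNneq C0 => c0; apply/eqP/matrixP => i j.
      by rewrite (ord1N i i0) (ord1N j i0) c0 mxE.
    apply/matrixP => i j; rewrite (ord1N i i0) (ord1N j i0).
    by apply: (mulfI c0); rewrite -!trC hCL hCt.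
  have Ns : s' <= Num.sqrt N%:R.
    rewrite ler_sqrt ?ler0n// (le_trans Phi'1) // ler1n; exact: ltnW.
  have [/andP[r0 r1] rg] := cube_gap_le _ _ _ _ s0 ss' Ns.
  apply: (@le_trans _ _ (1 - ((s' - s) / (Num.sqrt N%:R + s')) ^+ 3)).
    by rewrite lerD2l lerN2.
  rewrite dT -ler_ln ?posrE ?divr_gt0 ?subr_gt0// ln_div ?posrE//.
  (* Since [N%:R - 1] is at least 1 and the gap is nonnegative, the gap itself is at most [epsC]. *)
  have N2 : 2 <= N%:R :> R by rewrite ler_nat.
  move: hepsC hepsC0; rewrite /logdet => h1 h2.
  have h3 := le_trans h1 hepsstar.
  by move: h2 h3; set l := ln _; set l' := ln (\det XL); set l'' := ln (\det Xt); nra.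
have contr := gram_inv_contract _ _ _ _ uT trT q01 detT.
rewrite invT invf_div in contr.
pose l := s / frob Q; have l0 : 0 <= l by rewrite divr_ge0 ?(ltW s0) ?sqrtr_ge0.
pose Z := l *: (W^T *m Q *m W).
have sQ : Q^T = Q by rewrite hQ !trmx_mul trmxK hCsym mulmxA.
have sZ : symmx Z.
  rewrite /symmx /Z linearZ /= [(W^T *m Q *m W)^T]trmx_mul.
  by rewrite [(W^T *m Q)^T]trmx_mul trmxK sQ mulmxA.
have fQ : frob (W^T *m Q *m W) <= s' / s * frob Q.
  by apply: frob_conj_le contr; rewrite divr_ge0 ?(ltW s0) ?(ltW s'0).
(* The factor [s' / s] lost in the conjugation is exactly absorbed by [l = s / frob Q], leaving
   [frob Z <= s']. *)
have trZ : \tr (Z^T *m Z) <= Phi'.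
  rewrite -ler_sqrt ?(ltW Phi'0)// -/(frob Z) -/s' frobZ //.
  apply: (le_trans (ler_wpM2l l0 fQ)); rewrite /l.
  have [->|f0] := eqVneq (frob Q) 0; first by rewrite !mulr0 (ltW s'0).
  by rewrite mulrCA divfK // divfK ?gt_eqF.
have KY : K (1%:M - Z).
  by case: hK => -[-> PE]; [apply: isDD_ball|apply: isSDD_ball]; rewrite // -PE.
have WU : W *m UL = Ut by rewrite /W mulmxKV.
have UQU : Ut^T *m Q *m Ut = C.
  by rewrite hQ !mulmxA mulmxKV // -trmx_mul mulVmx // trmx1 mul1mx.
have XE : UL^T *m (1%:M - Z) *m UL = XL - l *: C.
  rewrite mulmxBr mulmxBl mulmx1 -XLE /Z -scalemxAr -scalemxAl; congr (_ - _ *: _).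
  by rewrite -UQU -WU [(W *m UL)^T]trmx_mul !mulmxA.
have XhE : Xhat = Xt - l *: C.
  by rewrite hXhat hYhat -/l mulmxBr mulmxBl mulmx1 -XtE -scalemxAr -scalemxAl UQU.
exists (UL^T *m (1%:M - Z) *m UL), (1%:M - Z); split=> // [i|].
  by rewrite XE mulmxBr -scalemxAr linearB linearZ /= hAL hAC mulr0 subr0.
by rewrite XE XhE !mulmxBr !linearB /= hCL hCt.
Qed.
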